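(* Let $A=\{a_1<a_2<\dots<a_n<\dots\}$ be an infinite subset of $\mathbb{N}=\{1,2,\dots\}$, let $g_n=a_{n+1}-a_n$, and put $$\alpha(A)=\liminf_{n\to\infty} n\frac{g_n}{a_{n+1}},\qquad \beta(A)=\limsup_{n\to\infty} n\frac{g_n}{a_n}$$ (values in $[0,+\infty]$). Then $$\frac{1}{\beta(A)}\le \underline{\varepsilon}(A)\le\overline{\varepsilon}(A)\le\frac{1}{\alpha(A)},$$ with the conventions $\frac1\infty=0$ and $\frac10=\infty$. In particular, if $\alpha(A)=\beta(A)$, then $A$ has exponential density $\varepsilon(A)=\frac1{\alpha(A)}=\frac1{\beta(A)}$.
   Context: For an infinite set $A\subseteq\mathbb{N}$ and real $x$, let $A(x)=|A\cap[1,x]|$. The upper and lower exponential densities of $A$ are $\overline{\varepsilon}(A)=\limsup_{k\to\infty}\frac{\log A(k)}{\log k}$ and $\underline{\varepsilon}(A)=\liminf_{k\to\infty}\frac{\log A(k)}{\log k}$. If they are equal, $A$ is said to have exponential density $\varepsilon(A)=\overline{\varepsilon}(A)=\underline{\varepsilon}(A)$. If $A=\{a_1<a_2<\dots\}$, then equivalently $\overline{\varepsilon}(A)=\limsup_{n\to\infty}\frac{\log n}{\log a_n}$ and $\underline{\varepsilon}(A)=\liminf_{n\to\infty}\frac{\log n}{\log a_n}$. *)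

(* Defs.v *)
From HB Require Import structures.
From mathcomp Require Import all_boot all_order all_algebra finmap.
From mathcomp Require Import all_classical all_reals all_analysis.
Set Implicit Arguments.
Unset Strict Implicit.
Unset Printing Implicit Defensive.
Import Order.TTheory GRing.Theory Num.Theory.
Local Open Scope classical_set_scope.
Local Open Scope ring_scope.

(* [A = {a 1 < a 2 < ...}]: indices start at 1, the value [a 0] is
   irrelevant. *)
Definition increasing_enumeration (A : set nat) (a : nat -> nat) : Prop :=
  (forall n, (1 <= n)%N -> (a n < a n.+1)%N) /\
  A = [set a n | n in [set n | (1 <= n)%N]].

Definition counting (A : set nat) (k : nat) : nat :=
  #|` fset_set (A `&` [set i | (1 <= i <= k)%N])|%fset.

(* [ln 0 = 0] and [x / 0 = 0] only affect the finitely many indices [k] with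
   [k <= 1] or [counting A k = 0], hence neither of the two limits. *)
Definition log_ratio (R : realType) (A : set nat) (k : nat) : \bar R :=
  (ln ((counting A k)%:R : R) / ln (k%:R : R))%:E.

Definition upper_exp_density (R : realType) (A : set nat) : \bar R :=
  limn_esup (log_ratio R A).

Definition lower_exp_density (R : realType) (A : set nat) : \bar R :=
  limn_einf (log_ratio R A).

Definition has_exp_density (R : realType) (A : set nat) (e : \bar R) : Prop :=
  lower_exp_density R A = e /\ upper_exp_density R A = e.

Definition gap (R : realType) (a : nat -> nat) (n : nat) : R :=
  (a n.+1)%:R - (a n)%:R.

Definition alpha (R : realType) (a : nat -> nat) : \bar R :=
  limn_einf (fun n => (n%:R * (gap R a n / (a n.+1)%:R))%:E).

Definition beta (R : realType) (a : nat -> nat) : \bar R :=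
  limn_esup (fun n => (n%:R * (gap R a n / (a n)%:R))%:E).

(* Main.v *)
Require Import Defs.
From HB Require Import structures.
From mathcomp Require Import all_boot all_order all_algebra finmap.
From mathcomp Require Import all_classical all_reals all_analysis.
From mathcomp Require Import ring lra.
Set Implicit Arguments.
Unset Strict Implicit.
Unset Printing Implicit Defensive.
Import Order.TTheory GRing.Theory Num.Theory.
Local Open Scope classical_set_scope.
Local Open Scope ereal_scope.

(** The gap conditions say how fast [ln a_n] grows compared with [ln n].

    Suppose that [0 < c < alpha]. For large [n], [c / n <= 1 - a_n / a_(n+1)],
    and [1 - t <= - ln t] turns this into [c / n <= ln a_(n+1) - ln a_n].
    As [ln (n + 1) - ln n <= 1 / n], the sequence [ln a_n - c ln n] is
    eventually nondecreasing, so [ln n <= ln a_n / c + C] ([ln_index_le]).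

    Suppose that [beta < b]. For large [n],
    [ln a_(n+1) - ln a_n <= a_(n+1) / a_n - 1 <= b / n], and now [1 / n] has to
    be bounded from above: [1 / n <= ln n - ln (n - 1)]. The shifted sequence
    [b ln (n - 1) - ln a_n] is therefore eventually nondecreasing, so
    [ln a_(n+1) / b + C <= ln n] ([ln_index_ge]). The shift of the index by one
    is harmless, indeed welcome: if [n] is the number of elements of [A] up to
    [k], then [a_n <= k < a_(n+1)] ([counting_near]), and each of the two
    estimates bounds [ln n] by a multiple of [ln k] plus a constant, from
    the side on which it is needed. As [ln k] tends to infinity, the constants
    disappear in the quotient [ln n / ln k] ([limn_esup_ratio_le],
    [limn_einf_ratio_ge]), so that the upper density is at most [1 / c] and the
    lower density at least [1 / b]. Letting [c] increase to [alpha] and [b]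
    decrease to [beta] gives the theorem; arguing by contradiction with
    [ge0_lte_dense] treats the values [0] and [+oo] of [alpha] and [beta]
    together with the finite positive ones. *)

(** * Upper and lower limits of sequences *)

Lemma limn_esup_le_near (R : realType) (u : nat -> \bar R) (l : \bar R) :
  (\forall n \near \oo, u n <= l) -> limn_esup u <= l.
Proof.
move=> ul.
apply: (@le_trans _ _ (ereal_sup (u @` [set n | u n <= l]))).
  by apply: ereal_inf_lbound; exists [set n | u n <= l].
by apply: ge_ereal_sup => _ [n /= unl <-].
Qed.

Lemma limn_einf_ge_near (R : realType) (u : nat -> \bar R) (l : \bar R) :
  (\forall n \near \oo, l <= u n) -> l <= limn_einf u.
Proof.
move=> lu; rewrite /limn_einf leeNr; apply: limn_esup_le_near.
by apply: filterS lu => n; rewrite leeN2.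
Qed.

Lemma limn_esup_lt_near (R : realType) (u : nat -> \bar R) (l : \bar R) :
  limn_esup u < l -> \forall n \near \oo, u n < l.
Proof.
move=> /ereal_inf_lt[_ [V Voo <-]] supVl.
apply: filterS Voo => n Vn; apply: le_lt_trans supVl.
by apply: ereal_sup_ubound; exists n.
Qed.

Lemma limn_einf_gt_near (R : realType) (u : nat -> \bar R) (l : \bar R) :
  l < limn_einf u -> \forall n \near \oo, l < u n.
Proof.
rewrite /limn_einf lteNr => /limn_esup_lt_near.
by apply: filterS => n; rewrite lteN2.
Qed.

(** Only the slope [l] survives in the limit, since [C / y k] tends to [0]. *)
Lemma limn_esup_ratio_le (R : realType) (x y : nat -> R) (l C : R) :
  y k @[k --> \oo] --> +oo%R ->
  (\forall k \near \oo, (x k <= l * y k + C)%R) ->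
  limn_esup (fun k => (x k / y k)%:E) <= l%:E.
Proof.
move=> yoo xy; apply/lee_addgt0Pr => e e0.
apply: limn_esup_le_near; near=> k.
have y0 : (0 < y k)%R by near: k; move/cvgryPgt: yoo; apply.
have yC : (C / e <= y k)%R by near: k; move/cvgryPge: yoo; apply.
have xk : (x k <= l * y k + C)%R by near: k.
rewrite -EFinD lee_fin ler_pdivrMr//.
move: yC; rewrite ler_pdivrMr// => yC.
by nra.
Unshelve. all: by end_near. Qed.

Lemma limn_einf_ratio_ge (R : realType) (x y : nat -> R) (l C : R) :
  y k @[k --> \oo] --> +oo%R ->
  (\forall k \near \oo, (l * y k + C <= x k)%R) ->
  l%:E <= limn_einf (fun k => (x k / y k)%:E).
Proof.
move=> yoo xy; rewrite /limn_einf leeNr -EFinN.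
rewrite [X in limn_esup X](_ : _ = (fun k => (- x k / y k)%:E)); last first.
  by apply/funext => k; rewrite mulNr EFinN.
apply: (limn_esup_ratio_le (C := - C)) => //.
by apply: filterS xy => k; lra.
Qed.

(** * Logarithms *)

Lemma ln_natr_cvgy (R : realType) : ln (k%:R : R) @[k --> \oo] --> +oo%R.
Proof.
apply/cvgryPge => M; near=> k.
have Mk : (expR M <= k%:R)%R by near: k; exact: nbhs_infty_ger.
by rewrite -ler_expR lnK// posrE (lt_le_trans _ Mk)// expR_gt0.
Unshelve. all: by end_near. Qed.

(** Concavity of [ln]: this one inequality serves for the increments of [ln n]
    and of [ln a_n], in both directions. *)
Lemma ln_sub_le (R : realType) (x y : R) :
  (0 < x)%R -> (0 < y)%R -> (ln x - ln y <= x / y - 1)%R.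
Proof.
move=> x0 y0; rewrite -ln_div ?posrE//.
have xy0 : (0 < x / y)%R by rewrite divr_gt0.
have {1}-> : (x / y = 1 + (x / y - 1))%R by lra.
by apply: le_ln1Dx; lra.
Qed.

Lemma nondecreasing_from (R : realType) (f : nat -> R) (N : nat) :
  (forall n, (N <= n)%N -> (f n <= f n.+1)%R) ->
  forall n, (N <= n)%N -> (f N <= f n)%R.
Proof.
move=> fS n /subnKC <-; elim: (n - N)%N => [|m IH]; first by rewrite addn0.
by rewrite addnS (le_trans IH)// fS// leq_addr.
Qed.

(** * The increasing enumeration and its counting function *)

Section enumeration.
Variables (A : set nat) (a : nat -> nat).
Hypotheses (A_pos : A `<=` [set n | (1 <= n)%N])
  (a_enum : increasing_enumeration A a).

(** The value [a 0] is arbitrary, so the monotone sequence is [a \o S]. *)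
Lemma enum_leq m n : (a m.+1 <= a n.+1)%N = (m <= n)%N.
Proof.
have [a_lt _] := a_enum.
apply: (@leq_mono (fun n => a n.+1)); apply: homo_ltn; first exact: ltn_trans.
by move=> i; exact: a_lt.
Qed.

Lemma enum_gt0 n : (1 <= n)%N -> (0 < a n)%N.
Proof.
by move=> n1; apply: A_pos; have [_ ->] := a_enum; exists n.
Qed.

Lemma leq_enum n : (n < a n.+1)%N.
Proof.
elim: n => [|n IH]; first exact: enum_gt0.
by apply: leq_ltn_trans IH _; have [a_lt _] := a_enum; exact: a_lt.
Qed.

Lemma counting_enum n k : (a n.+1 <= k < a n.+2)%N -> Defs.counting A k = n.+1.
Proof.
move=> /andP[ank kan]; apply: card_fset_set.
suff -> : A `&` [set i | (1 <= i <= k)%N] = (fun i => a i.+1) @` `I_n.+1.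
  apply: inj_card_eq => i j _ _ aij; apply/eqP.
  by rewrite eqn_leq -enum_leq -(enum_leq j) aij leqnn.
have [_ AE] := a_enum; rewrite AE; apply/seteqP; split => [i|_ [i /= iltn <-]].
  move=> [[[//|m] _ <-]] /= /andP[_ amk]; exists m => //=.
  by rewrite ltnNge -enum_leq -ltnNge (leq_ltn_trans amk).
split; first by exists i.+1.
by rewrite /= enum_gt0//= (leq_trans _ ank)// enum_leq.
Qed.

(** The counting function is the inverse of the enumeration: it tends to
    infinity, and its value [n] at [k] locates [k] between [a n] and
    [a n.+1]. *)
Lemma counting_near N : \forall k \near \oo,
  [/\ (N <= Defs.counting A k)%N, (a (Defs.counting A k) <= k)%N
    & (k < a (Defs.counting A k).+1)%N].
Proof.
near=> k.
have aNk : (a N.+1 <= k)%N by near: k; exact: nbhs_infty_ge.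
have ubk n : (a n.+1 <= k)%N -> (n <= k)%N.
  by apply: leq_trans; exact/ltnW/leq_enum.
have [n ank nmax] := @ex_maxnP (fun n => a n.+1 <= k)%N k (ex_intro _ N aNk) ubk.
have kan : (k < a n.+2)%N by rewrite ltnNge; apply/negP => /nmax; rewrite ltnn.
rewrite (@counting_enum n) ?ank//; split=> //.
exact/leqW/nmax.
Unshelve. all: by end_near. Qed.

(** * Growth of the enumeration *)

Variable R : realType.
Local Open Scope ring_scope.

Lemma natr_enum_gt0 n : (1 <= n)%N -> 0 < (a n)%:R :> R.
Proof. by move=> /enum_gt0; rewrite ltr0n. Qed.

Lemma gap_ge0 n : (1 <= n)%N -> 0 <= gap R a n.
Proof.
move=> n1; have [a_lt _] := a_enum.
by rewrite subr_ge0 ler_nat ltnW// a_lt.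
Qed.

(** The gap condition makes [ln (a n) / c - ln n] nondecreasing from [N] on;
    [- C] is its value at [N]. *)
Lemma ln_index_le (c : R) (N : nat) : 0 < c -> (1 <= N)%N ->
  (forall n, (N <= n)%N -> c <= n%:R * (gap R a n / (a n.+1)%:R)) ->
  exists C, forall n, (N <= n)%N -> ln n%:R <= c^-1 * ln (a n)%:R + C.
Proof.
move=> c0 N1 cgap.
exists (- (c^-1 * ln (a N)%:R - ln N%:R)) => n Nn; rewrite lerBrDr -lerBrDl.
apply: (@nondecreasing_from _ (fun n => c^-1 * ln (a n)%:R - ln n%:R) N _ n Nn) => m Nm.
have m1 := leq_trans N1 Nm.
have m0 : 0 < m%:R :> R by rewrite ltr0n.
have am0 := natr_enum_gt0 m1; have aS0 := natr_enum_gt0 (ltn0Sn m).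
have lna := ln_sub_le am0 aS0.
have := @ln_sub_le R m.+1%:R m%:R (ltr0Sn _ _) m0.
have -> : m.+1%:R / m%:R - 1 = m%:R^-1 :> R.
  by rewrite -natr1; field; rewrite gt_eqF.
move=> lnm.
have := cgap m Nm; rewrite /gap mulrBl divff ?gt_eqF// -ler_pdivrMl// => cm.
rewrite -lerBrDr -lerBlDl.
suff : ln m.+1%:R - ln m%:R <= c^-1 * (ln (a m.+1)%:R - ln (a m)%:R) by lra.
rewrite -(ler_pM2l c0) mulVKf ?gt_eqF//.
by apply: le_trans (_ : c * m%:R^-1 <= _); [rewrite ler_pM2l|lra].
Qed.

(** The gap condition makes [ln (n - 1) - ln (a n) / b] nondecreasing from [N]
    on, and [C] is its value at [N]; the term [ln (n - 1)] forces [2 <= N].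
    Comparing with the term of index [n + 1] is what relates [a n.+1] to [n]. *)
Lemma ln_index_ge (b : R) (N : nat) : 0 < b -> (2 <= N)%N ->
  (forall n, (N <= n)%N -> n%:R * (gap R a n / (a n)%:R) <= b) ->
  exists C, forall n, (N <= n)%N -> b^-1 * ln (a n.+1)%:R + C <= ln n%:R.
Proof.
move=> b0 N2 gapb.
exists (ln N.-1%:R - b^-1 * ln (a N)%:R) => n Nn.
suff : ln N.-1%:R - b^-1 * ln (a N)%:R <= ln n%:R - b^-1 * ln (a n.+1)%:R by lra.
apply: (@nondecreasing_from _ (fun n => ln n.-1%:R - b^-1 * ln (a n)%:R) N _ n.+1);
  last exact: leqW.
move=> m Nm /=; have m2 := leq_trans N2 Nm; have m1 := ltnW m2.
have m0 : 0 < m%:R :> R by rewrite ltr0n.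
have p0 : 0 < m.-1%:R :> R by rewrite ltr0n; case: (m) m2 => [|[]].
have am0 := natr_enum_gt0 m1; have aS0 := natr_enum_gt0 (ltn0Sn m).
have lna := ln_sub_le aS0 am0.
have := ln_sub_le p0 m0.
have -> : m.-1%:R / m%:R - 1 = - m%:R^-1 :> R.
  have -> : m%:R = m.-1%:R + 1 :> R by rewrite natr1 prednK.
  by field; rewrite natr1 prednK// gt_eqF.
move=> lnm.
have := gapb m Nm; rewrite /gap mulrBl divff ?gt_eqF// -ler_pdivlMl// => bm.
suff : b^-1 * (ln (a m.+1)%:R - ln (a m)%:R) <= ln m%:R - ln m.-1%:R by lra.
rewrite -(ler_pM2l b0) mulVKf ?gt_eqF//.
by apply: le_trans (_ : b * m%:R^-1 <= _); [lra|rewrite ler_pM2l//; lra].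
Qed.

(** * Bounds on the exponential densities *)

Lemma upper_exp_density_le (c : R) : 0 < c -> (c%:E < alpha R a)%E ->
  (upper_exp_density R A <= c^-1%:E)%E.
Proof.
move=> c0 /limn_einf_gt_near[N _ cN].
have [|n Nn|C HC] := @ln_index_le c N.+1 c0.
- by [].
- by have := cN n (ltnW Nn); rewrite lte_fin => /ltW.
apply: (@limn_esup_ratio_le R _ _ _ C); first exact: ln_natr_cvgy.
apply: filterS (counting_near N.+1) => k [Nk ak _].
apply: le_trans (HC _ Nk) _; rewrite lerD2r ler_pM2l ?invr_gt0//.
have a0 := enum_gt0 (leq_trans (ltn0Sn N) Nk).
by rewrite ler_ln ?posrE ?ltr0n ?ler_nat// (leq_trans a0).
Qed.

Lemma lower_exp_density_ge (b : R) : 0 < b -> (beta R a < b%:E)%E ->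
  (b^-1%:E <= lower_exp_density R A)%E.
Proof.
move=> b0 /limn_esup_lt_near[N _ bN].
have [|n Nn|C HC] := @ln_index_ge b N.+2 b0.
- by [].
- by have := bN n (ltnW (ltnW Nn)); rewrite lte_fin => /ltW.
apply: (@limn_einf_ratio_ge R _ _ _ C); first exact: ln_natr_cvgy.
apply: filterS (counting_near N.+2) => k [Nk ak ka].
apply: le_trans (HC _ Nk); rewrite lerD2r ler_pM2l ?invr_gt0//.
have a0 := enum_gt0 (leq_trans (ltn0Sn _) Nk).
have k0 := leq_trans a0 ak.
by rewrite ler_ln ?posrE ?ltr0n ?ler_nat ?(ltnW ka)// (leq_trans k0)// ltnW.
Qed.

Lemma lower_exp_density_ge0 : (0 <= lower_exp_density R A)%E.
Proof.
apply: limn_einf_ge_near; near=> k; rewrite lee_fin.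
have ln_nat_ge0 n : 0 <= ln n%:R :> R.
  by case: n => [|n]; [rewrite ln0|rewrite ln_ge0// ler1n].
by rewrite divr_ge0.
Unshelve. all: by end_near. Qed.

Lemma alpha_ge0 : (0 <= alpha R a)%E.
Proof.
apply: limn_einf_ge_near; near=> n; rewrite lee_fin mulr_ge0// divr_ge0//.
by apply: gap_ge0; near: n; exact: nbhs_infty_ge.
Unshelve. all: by end_near. Qed.

Lemma beta_ge0 : (0 <= beta R a)%E.
Proof.
apply: le_trans (limn_einf_sup _).
apply: limn_einf_ge_near; near=> n; rewrite lee_fin mulr_ge0// divr_ge0//.
by apply: gap_ge0; near: n; exact: nbhs_infty_ge.
Unshelve. all: by end_near. Qed.

End enumeration.

(** * Reciprocal bounds in the extended reals *)

Lemma ge0_lte_dense (R : realType) (x y : \bar R) : 0 <= x -> x < y ->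
  exists2 r : R, (0 < r)%R & x < r%:E < y.
Proof.
case: x => [x| |]// x0; last by rewrite ltNge leey.
rewrite lee_fin in x0.
case: y => [y| |]// xy.
- rewrite lte_fin in xy; exists ((x + y) / 2)%R; first by lra.
  by rewrite !lte_fin; apply/andP; split; lra.
- by exists (x + 1)%R; [lra|rewrite ltry lte_fin; apply/andP; split; lra].
Qed.

(* [inve], written [x^-1] here, satisfies [0^-1 = +oo] and [+oo^-1 = 0]. *)
Theorem proposition3p7 (R : realType) (A : set nat) (a : nat -> nat)
  (A_infinite : infinite_set A)
  (A_pos : A `<=` [set n | (1 <= n)%N])
  (a_enum : increasing_enumeration A a) :
  [/\ (beta R a)^-1 <= lower_exp_density R A,
      lower_exp_density R A <= upper_exp_density R A,
      upper_exp_density R A <= (alpha R a)^-1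
    & alpha R a = beta R a ->
      has_exp_density A (alpha R a)^-1 /\ has_exp_density A (beta R a)^-1].
Proof.
have low0 := lower_exp_density_ge0 A R.
have low_up : lower_exp_density R A <= upper_exp_density R A.
  exact: limn_einf_sup.
have up0 := le_trans low0 low_up.
have al0 := alpha_ge0 a_enum R; have be0 := beta_ge0 a_enum R.
have low_ge : (beta R a)^-1 <= lower_exp_density R A.
  rewrite leNgt; apply/negP; rewrite inve_pgt ?inE//.
  move=> /(ge0_lte_dense be0)[b b0 /andP[beb]].
  have be_ge0 : 0 <= b%:E by rewrite lee_fin ltW.
  rewrite ltNge inve_ple ?inE// => /negP; apply.
  by rewrite inver gt_eqF//; exact: lower_exp_density_ge beb.
have up_le : upper_exp_density R A <= (alpha R a)^-1.
  rewrite leNgt; apply/negP; rewrite inve_plt ?inE// => up_al.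
  have [|c c0 /andP[+ cal]] := ge0_lte_dense _ up_al; first by rewrite inve_ge0.
  have ce_ge0 : 0 <= c%:E by rewrite lee_fin ltW.
  rewrite ltNge inve_pge ?inE// => /negP; apply.
  by rewrite inver gt_eqF//; exact: upper_exp_density_le cal.
split=> // ab.
suff : has_exp_density A (alpha R a)^-1 by rewrite -ab.
split; apply/eqP; rewrite eq_le.
- by rewrite (le_trans low_up up_le) ab low_ge.
- by rewrite up_le ab (le_trans low_ge low_up).
Qed.
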